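(* Let $G=(I,D)$ be any graph (possibly infinite), with set of cliques $\mathcal{C}$, and let $(E_i)_{i\in I}$ be any collection of sets. Then $$\bigcap_{(i,j):\ i\neq j,\ i\notin\partial j}\mathcal{F}_{\widehat{[i,j]}}=\bigcap_{i\in I}\mathcal{F}_{\widehat{[i]}}=\mathcal{F}_{\mathcal{C}}.$$
   Context: $G$ is an undirected graph without loops with vertex set $I$; $\partial i$ is the set of vertices adjacent to $i$. A clique of $G$ is a subset of $I$ in which every two distinct vertices are adjacent (so $\emptyset$ and singletons are cliques). For $i,j\in I$, $[i,j]=\{I\setminus\{i\},\,I\setminus\{j\}\}$ and $[i]=\{I\setminus\{i\},\,\{i\}\cup\partial i\}$, which are subsets of the power set $\mathcal{P}(I)$. For $\mathcal{A}\subseteq\mathcal{P}(I)$, $\hat{\mathcal{A}}=\widehat{\mathcal{A}}=\{a\subseteq I:\exists b\in\mathcal{A},\ a\subseteq b\}$. $E_a=\prod_{i\in a}E_i$ for $a\subseteq I$ ($E_\emptyset$ a one-point set), and $x_a$ is the projection of $x\in E_I$ onto $E_a$. For $\mathcal{A}\subseteq\mathcal{P}(I)$, the generalized factorisation space $\mathcal{F}_{\mathcal{A}}$ is the set of functions $f:E_I\to\mathbb{R}_{>0}$ for which there are an integer $n\ge 0$, finite sets $a_1,\dots,a_n\in\hat{\mathcal{A}}$ and functions $f_k:E_{a_k}\to\mathbb{R}_{>0}$ such that $f(x)=\prod_{k=1}^n f_k(x_{a_k})$ for all $x\in E_I$ (empty product $=1$). An intersection of factorisation spaces over an empty index set is $\mathcal{F}_{\mathcal{P}(I)}$.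 *)

(* Defs.v *)
From mathcomp Require Import all_boot all_order all_algebra.
From mathcomp Require Import boolp classical_sets cardinality reals interval_inference.
Set Implicit Arguments.
Unset Strict Implicit.
Unset Printing Implicit Defensive.
Import Order.TTheory GRing.Theory Num.Theory.
Local Open Scope classical_set_scope.
Local Open Scope ring_scope.

(* [nbhd G i] is the set of vertices adjacent to [i]. *)
Record graph (I : Type) := Graph {
  nbhd : I -> set I;
  nbhd_sym : forall i j : I, nbhd i j -> nbhd j i;
  nbhd_irr : forall i : I, ~ nbhd i i
}.

Definition cliques (I : Type) (G : graph I) : set (set I) :=
  [set a | forall i j : I, a i -> a j -> i <> j -> nbhd G i j].

Definition hat (I : Type) (A : set (set I)) : set (set I) :=
  [set a | exists2 b : set I, A b & a `<=` b].

(* [pair_family i j] is the family usually written $[i,j]$, and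
   [vertex_family G i] the one written $[i]$. *)
Definition pair_family (I : Type) (i j : I) : set (set I) :=
  [set [set~ i]; [set~ j]].

Definition vertex_family (I : Type) (G : graph I) (i : I) : set (set I) :=
  [set [set~ i]; i |` nbhd G i].

Definition prod_space (I : Type) (E : I -> Type) : Type := forall i : I, E i.

Definition sub_prod_space (I : Type) (E : I -> Type) (a : set I) : Type :=
  forall i : a, E (\val i).

Definition proj (I : Type) (E : I -> Type) (a : set I) (x : prod_space E) :
    sub_prod_space E a :=
  fun i : a => x (\val i).

Arguments proj {I E} a x _.

Definition fact_space (R : realType) (I : Type) (E : I -> Type)
    (A : set (set I)) : set (prod_space E -> {posnum R}) :=
  [set f | exists (n : nat) (a : 'I_n -> set I)
             (phi : forall k : 'I_n, sub_prod_space E (a k) -> {posnum R}),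
     (forall k : 'I_n, finite_set (a k) /\ hat A (a k)) /\
     (forall x : prod_space E,
        (f x)%:num = \prod_(k < n) (phi k (proj (a k) x))%:num)].

Arguments fact_space R {I} E A _.

(* An intersection over an empty index set is, by convention, the factorisation
   space of the full power set, not the set of all positive functions. *)
Definition fact_cap (R : realType) (I : Type) (E : I -> Type) (J : Type)
    (P : set J) (A : J -> set (set I)) : set (prod_space E -> {posnum R}) :=
  if P == set0 then fact_space R E setT
  else \bigcap_(j in P) fact_space R E (A j).

Arguments fact_cap R {I} E {J} P A _.

Definition nonadjacent_pairs (I : Type) (G : graph I) : set (I * I) :=
  [set p | p.1 <> p.2 /\ ~ nbhd G p.2 p.1].

(* Main.v *)
Require Import Defs.
From mathcomp Require Import all_boot all_order all_algebra.
From mathcomp Require Import boolp classical_sets cardinality reals interval_inference.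
Local Open Scope classical_set_scope.

(** The equality of the three spaces reduces to one nontrivial inclusion: a
    function [f] lying in the space of every nonadjacent pair factorises over
    the cliques.

    Fix a base point [o] and let [erase o i x] be [x] with coordinate [i] reset
    to [o i]. Factorising over [[set~ i]; [set~ j]] gives the exchange identity
    [f x * f (x erased at i and j) = f (x erased at i) * f (x erased at j)]
    ([pair_exchange]), which expresses [f] through three functions
    that each ignore [i] or [j]. If moreover [f] is a product of local factors
    with supports [a_1, ..., a_n], then these three functions are the products
    of the same factors with [i], [j] or both removed from the supports.
    Hence [f] factorises over the subsets of [a_1, ..., a_n] that do not
    contain both [i] and [j] ([factorable_separate]).

    Membership in any of the spaces forces [f] to factorise over the subsets of
    one finite set [a]. Only finitely many nonadjacent pairs have both entries
    in [a]; separating them one after another ([factorable_separate_all])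
    leaves only supports that contain no nonadjacent pair, that is, cliques.

    Without a base point the product space is empty, and the empty product
    represents every function on it. *)

Set Implicit Arguments.
Unset Strict Implicit.
Unset Printing Implicit Defensive.
Import Order.TTheory GRing.Theory Num.Theory.
Local Open Scope ring_scope.

(** * Products of local factors *)

Section Factorable.
Variables (R : realType) (I : Type) (E : I -> Type).
Implicit Types (x y o : prod_space E) (f g : prod_space E -> R).
Implicit Types (a : set I) (A B : set (set I)) (i j : I).

Definition depends_only_on a g :=
  forall x y, (forall i, a i -> x i = y i) -> g x = g y.

Definition local_factor B g :=
  (forall x, 0 < g x) /\
  exists a, [/\ finite_set a, B a & depends_only_on a g].

(** Factors are functions on the whole product space, so that composing them
    with a map of that space involves no transport between the types attached
    to different supports. *)
Definition factorable B f :=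
  exists (n : nat) (g : 'I_n -> prod_space E -> R),
    (forall k, local_factor B (g k)) /\ forall x, f x = \prod_(k < n) g k x.

Definition extend o a (y : sub_prod_space E a) : prod_space E :=
  fun i => if pselect (i \in a) is left ia then y (exist _ i ia) else o i.

Lemma extend_proj o a x i : a i -> extend o (proj a x) i = x i.
Proof. by move=> ai; rewrite /extend; case: pselect => // -[]; rewrite inE. Qed.

(** The base point turns a factor defined on [E_a] into a function on the whole
    space: coordinates outside [a] are filled in from [o]. *)
Lemma fact_spaceP o A (f : prod_space E -> {posnum R}) :
  fact_space R E A f <-> factorable (hat A) (fun x => (f x)%:num).
Proof.
split=> [[n [a [phi [aA fE]]]]|[n [g [gA fE]]]].
  exists n, (fun k x => (phi k (proj (a k) x))%:num); split=> // k; split=> //.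
  exists (a k); have [afin ak] := aA k; split=> // x y xy.
  congr ((phi k _)%:num); apply: functional_extensionality_dep => -[i ia].
  by apply: xy; exact: set_mem ia.
have [a aP] := choice (fun k => (gA k).2).
exists n, a, (fun k z => PosNum ((gA k).1 (extend o z))).
split=> [k|x]; first by have [? ? _] := aP k.
rewrite fE; apply: eq_bigr => k _ /=.
by have [_ _ ag] := aP k; apply: ag => i ai; rewrite extend_proj.
Qed.

Lemma sub_local_factor A B g :
  A `<=` B -> local_factor A g -> local_factor B g.
Proof.
move=> AB [g0 [a [afin Aa ga]]]; split=> //.
by exists a; split=> //; apply: AB.
Qed.

Lemma sub_factorable A B f : A `<=` B -> factorable A f -> factorable B f.
Proof.
move=> AB [n [g [gA fE]]]; exists n, g; split=> // k.
exact: sub_local_factor AB (gA k).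
Qed.

Lemma factorable_gt0 B f x : factorable B f -> 0 < f x.
Proof.
by move=> [n [g [gB ->]]]; apply: prodr_gt0 => k _; have [+ _] := gB k; exact.
Qed.

Lemma factorableM B f g :
  factorable B f -> factorable B g -> factorable B (fun x => f x * g x).
Proof.
move=> [m [u [uB fE]]] [n [v [vB gE]]].
exists (m + n)%N,
  (fun k => match split k with inl k1 => u k1 | inr k2 => v k2 end).
split=> [k|x]; first by case: (split k).
rewrite fE gE big_split_ord; congr (_ * _); apply: eq_bigr => k _.
  by rewrite (unsplitK (inl _ k)).
by rewrite (unsplitK (inr _ k)).
Qed.

Lemma factorableV B f : factorable B f -> factorable B (fun x => (f x)^-1).
Proof.
move=> [n [g [gB fE]]]; exists n, (fun k x => (g k x)^-1).
split=> [k|x]; last by rewrite fE prodfV.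
have [g0 [a [afin Ba ga]]] := gB k.
split=> [x|]; first by rewrite invr_gt0.
by exists a; split=> // x y xy; rewrite (ga x y).
Qed.

Lemma factorable_bounded B f : factorable B f ->
  exists2 a, finite_set a & factorable [set b | b `<=` a] f.
Proof.
move=> [n [g [gB fE]]].
have [a aP] := choice (fun k => (gB k).2).
exists (\bigcup_k a k).
  by apply: bigcup_finite => // k _; have [] := aP k.
exists n, g; split=> // k; split; first by have [] := gB k.
have [afin _ ag] := aP k; exists (a k); split=> //.
exact: bigcup_sup.
Qed.

(** ** Separating nonadjacent vertices *)

Definition erase o i x : prod_space E :=
  fun j => if `[< j = i >] then o j else x j.

Lemma erase_neq o i x j : j <> i -> erase o i x j = x j.
Proof. by move=> ji; rewrite /erase asboolF. Qed.

Lemma factorable_erase B B' o i f :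
    (forall a, B a -> B' (a `\ i)) ->
  factorable B f -> factorable B' (fun x => f (erase o i x)).
Proof.
move=> BB' [n [g [gB fE]]]; exists n, (fun k x => g k (erase o i x)).
split=> [k|x]; last exact: fE.
have [g0 [a [afin Ba ga]]] := gB k; split=> //.
exists (a `\ i); split; [exact: finite_setD|exact: BB'|move=> x y xy].
apply: ga => j aj; rewrite /erase; case: asboolP => // ji.
exact: xy.
Qed.

(** The identity is multiplicative in [f], so one local factor suffices; such a
    factor ignores [i] or ignores [j], and the two sides then agree factor by
    factor. *)
Lemma pair_exchange o i j f :
    factorable (hat (pair_family i j)) f ->
  forall x, f x * f (erase o i (erase o j x))
          = f (erase o i x) * f (erase o j x).
Proof.
move=> [n [g [gB fE]]] x; rewrite !fE -!big_split /=.
apply: eq_bigr => k _; have [_ [a [_ [b bij ab] ga]]] := gB k.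
case: bij => -> in ab.
  have gi y : g k (erase o i y) = g k y.
    by apply: ga => l /ab li; rewrite erase_neq.
  by rewrite !gi.
have gj y z : (forall l, l <> j -> y l = z l) -> g k y = g k z.
  by move=> yz; apply: ga => l /ab /yz.
rewrite mulrC; congr (_ * _); apply: gj => l lj.
  by rewrite /erase (asboolF lj).
by rewrite erase_neq.
Qed.

(** Solve the exchange identity for [f]. On the right, every support has lost
    [i] or [j]; being a subset of a member of the down-closed [B], it is still
    in [B]. *)
Lemma factorable_separate o B i j f :
    (forall a b, a `<=` b -> B b -> B a) ->
    factorable B f -> factorable (hat (pair_family i j)) f ->
  factorable [set a | B a /\ ~ (a i /\ a j)] f.
Proof.
move=> Bdown fB fij.
have -> : f = fun x => f (erase o i x) * f (erase o j x)
                       * (f (erase o i (erase o j x)))^-1.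
  apply: functional_extensionality_dep => x.
  rewrite -(pair_exchange o fij) mulfK // gt_eqF //.
  exact: factorable_gt0 fB.
have Bi (a : set I) : B a -> B (a `\ i) by apply: Bdown => l [].
have Bj (a : set I) : B a -> B (a `\ j) by apply: Bdown => l [].
apply: factorableM; first apply: factorableM.
- apply: factorable_erase fB => a Ba; split; first exact: Bi.
  by case=> -[_ /(_ erefl)].
- apply: factorable_erase fB => a Ba; split; first exact: Bj.
  by case=> _ [_ /(_ erefl)].
- apply: factorableV; have fi := factorable_erase o Bi fB.
  apply: factorable_erase fi => a Ba; split; first exact: Bj.
  by case=> _ [_ /(_ erefl)].
Qed.

(** Iteration loses nothing gained so far: avoiding a pair passes to subsets,
    so the family reached after each step is again down-closed. *)
Lemma factorable_separate_all o B f (s : seq {classic I * I}) :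
    (forall a b, a `<=` b -> B b -> B a) ->
    factorable B f ->
    (forall p, p \in s -> factorable (hat (pair_family p.1 p.2)) f) ->
  factorable [set a | B a /\ forall p, p \in s -> ~ (a p.1 /\ a p.2)] f.
Proof.
move=> Bdown fB; elim: s => [_|p s IHs fs].
  by apply: sub_factorable fB => a.
have fB' := IHs (fun q qs => fs q (mem_behead (s := p :: s) qs)).
have fp := fs p (mem_head p s).
apply: sub_factorable (factorable_separate o _ fB' fp) => [a|a b ab] /=.
  move=> [[Ba as_] ap]; split=> // q.
  by rewrite inE => /orP [/eqP -> //|]; exact: as_.
move=> [Bb bs]; split; first exact: Bdown ab Bb.
by move=> q qs [/ab b1 /ab b2]; apply: (bs q).
Qed.

(** Once the supports lie in a finite [a], only the finitely many nonadjacent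
    pairs within [a] have to be separated, even when [G] is infinite. *)
Lemma factorable_cliques o (G : graph I) f :
    factorable setT f ->
    (forall p, nonadjacent_pairs G p ->
       factorable (hat (pair_family p.1 p.2)) f) ->
  factorable (cliques G) f.
Proof.
move=> /factorable_bounded [a afin fa] fG.
have : finite_set ((a `*` a) `&` nonadjacent_pairs G : set {classic I * I}).
  exact/finite_setIl/finite_setX.
move=> /finite_seqP [s sE].
have down b c : b `<=` c -> [set d | d `<=` a] c -> [set d | d `<=` a] b.
  exact: subset_trans.
have sG p : p \in s -> factorable (hat (pair_family p.1 p.2)) f.
  move=> ps; apply: fG; have : [set` s] p by [].
  by rewrite -sE => -[].
apply: sub_factorable (factorable_separate_all o down fa sG).
move=> b [ba bs] i j bi bj ij; apply: contrapT => Gij.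
apply: (bs (i, j)) => //; suff : [set` s] (i, j) by [].
rewrite -sE; split; first by split; exact: ba.
by split=> //= Gji; apply: Gij; exact: nbhd_sym.
Qed.

End Factorable.

(** * Comparison of the factorisation spaces *)

Section FactSpace.
Variables (R : realType) (I : Type) (E : I -> Type).

Lemma sub_fact_space (A B : set (set I)) :
  A `<=` hat B -> fact_space R E A `<=` fact_space R E B.
Proof.
move=> AB f [n [a [phi [aA fE]]]]; exists n, a, phi; split=> // k.
have [afin [b /AB [c Bc bc] ab]] := aA k.
by split=> //; exists c => //; exact: subset_trans bc.
Qed.

(** The convention for empty intersections makes this hold for every index set:
    each factorisation space lies in the one of the full power set. *)
Lemma fact_capP (J : Type) (P : set J) (A : J -> set (set I)) f :
  fact_cap R E P A f <->
  fact_space R E setT f /\ forall j, P j -> fact_space R E (A j) f.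
Proof.
rewrite /fact_cap; case: eqP => [->|/eqP /set0P [j Pj]].
  by split=> [fT|[]] //; split=> // j [].
split=> [fP|[_ fP] k] //; last exact: fP.
split=> //; apply: (sub_fact_space (A := A j)); last exact: fP.
by move=> a _; exists a.
Qed.

(** A clique through [i] lies in the closed neighbourhood of [i]; any other
    clique avoids [i]. *)
Lemma fact_space_cliques_vertex (G : graph I) i :
  fact_space R E (cliques G) `<=` fact_space R E (hat (vertex_family G i)).
Proof.
apply: sub_fact_space => a aG; exists a => //.
have [ai|nai] := pselect (a i).
  exists (i |` nbhd G i); first by right.
  by move=> j aj; have [->|ij] := pselect (j = i); [left|right; apply: aG => // /esym].
by exists [set~ i]; [left|move=> j aj ji; apply: nai; rewrite -ji].
Qed.

(** The closed neighbourhood of [i] avoids each [j] that is distinct from [i]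
    and not adjacent to it. *)
Lemma fact_space_vertex_pair (G : graph I) (i j : I) :
    nonadjacent_pairs G (i, j) ->
  fact_space R E (hat (vertex_family G i)) `<=`
  fact_space R E (hat (pair_family i j)).
Proof.
move=> [/= ij Gji]; apply: sub_fact_space => a [b [->|->] ab].
  by exists a => //; exists [set~ i] => //; left.
exists a => //; exists [set~ j]; first by right.
by move=> k /ab [->//|Gik] kj; apply: Gji; apply: nbhd_sym; rewrite -kj.
Qed.

Lemma fact_space_pairs_cliques (G : graph I) (f : prod_space E -> {posnum R}) :
    fact_space R E setT f ->
    (forall p, nonadjacent_pairs G p ->
       fact_space R E (hat (pair_family p.1 p.2)) f) ->
  fact_space R E (cliques G) f.
Proof.
move=> fT fG; have [[o _]|noE] := pselect (exists o : prod_space E, True);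
  last first.
  (* No base point: all functions on the empty product space are equal. *)
  exists 0%N, (fun=> set0), (fun _ _ => 1%:pos); split=> [[]//|x].
  by exfalso; apply: noE; exists x.
have hatS (A B : set (set I)) g :
    hat A `<=` B -> fact_space R E A g -> factorable B (fun x => (g x)%:num).
  by move=> AB /(fact_spaceP o); apply: sub_factorable.
apply/(fact_spaceP o).
apply: (@sub_factorable _ _ _ (cliques G)); first by move=> a ?; exists a.
apply: (factorable_cliques o).
  exact: hatS fT.
move=> p /fG; apply: hatS => a [b [c cp bc] ab].
by exists c => //; exact: subset_trans bc.
Qed.

End FactSpace.

Theorem corollary5p3 (R : realType) (I : Type) (G : graph I) (E : I -> Type) :
  fact_cap R E (nonadjacent_pairs G) (fun p => hat (pair_family p.1 p.2))
    = fact_cap R E [set: I] (fun i => hat (vertex_family G i)) /\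
  fact_cap R E [set: I] (fun i => hat (vertex_family G i))
    = fact_space R E (cliques G).
Proof.
set pairs := fact_cap R E (nonadjacent_pairs G) _.
set vertices := fact_cap R E [set: I] _.
have cliques_vertices : fact_space R E (cliques G) `<=` vertices.
  move=> f fC; apply/fact_capP; split=> [|i _].
    by apply: sub_fact_space fC => a _; exists a.
  exact: fact_space_cliques_vertex.
have vertices_pairs : vertices `<=` pairs.
  move=> f /fact_capP [fT fV]; apply/fact_capP; split=> // -[i j] Gij.
  exact: fact_space_vertex_pair Gij _ (fV i _).
have pairs_cliques : pairs `<=` fact_space R E (cliques G).
  by move=> f /fact_capP [fT fP]; exact: fact_space_pairs_cliques.
by split; apply/seteqP; split=> // f; [move=> /pairs_cliques|move=> /vertices_pairs];
  auto.
Qed.
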